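(* Let $K=\mathbb{Q}(\sqrt{2})$ with ring of integers $O_K$, and let $$f_4(q):=\sum_{n=0}^{\infty}\frac{(q)_{2n+1}}{(-q)_{2n+2}}\,q^{n+1}.$$ Then $$f_4(q)=-\sum_{\mathbf{a}\subset O_K}(-1)^{\mathcal{N}(\mathbf{a})}q^{\mathcal{N}(\mathbf{a})},$$ where the sum runs over all nonzero ideals $\mathbf{a}$ of $O_K$.
   Context: Identities are between formal power series in $q$ (equivalently, for $|q|<1$). Notation: $(a)_n=(a;q)_n:=\prod_{j=0}^{n-1}(1-aq^j)$, so that $(q)_n=\prod_{j=1}^n(1-q^j)$ and $(-q)_n=\prod_{j=1}^n(1+q^j)$. For an ideal $\mathbf{a}$ of $O_K$, $\mathcal{N}(\mathbf{a})=|O_K/\mathbf{a}|$ is its norm. *)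

(* Defs.v *)
From HB Require Import structures.
From mathcomp Require Import all_boot all_order all_algebra all_field.
From mathcomp Require Import finmap all_classical.

Set Implicit Arguments.
Unset Strict Implicit.
Unset Printing Implicit Defensive.

Import Order.TTheory GRing.Theory Num.Theory.
Local Open Scope ring_scope.
Local Open Scope classical_set_scope.

Record fps (R : Type) := Fps { fps_coef : nat -> R }.
Coercion fps_coef : fps >-> Funclass.

HB.instance Definition _ (R : Type) := [isNew for @fps_coef R].
HB.instance Definition _ (R : choiceType) := [Choice of fps R by <:].

Lemma fpsP (R : Type) (f g : fps R) : f =1 g <-> f = g.
Proof. by split=> [fg|->//]; apply/val_inj/funext. Qed.

Section FpsZmodule.
Variable R : zmodType.
Implicit Types f g h : fps R.

Definition fps_zero : fps R := Fps (fun=> 0).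
Definition fps_opp f : fps R := Fps (fun n => - f n).
Definition fps_add f g : fps R := Fps (fun n => f n + g n).

Fact fps_addA : associative fps_add.
Proof. by move=> f g h; apply/fpsP=> n /=; rewrite addrA. Qed.
Fact fps_addC : commutative fps_add.
Proof. by move=> f g; apply/fpsP=> n /=; rewrite addrC. Qed.
Fact fps_add0 : left_id fps_zero fps_add.
Proof. by move=> f; apply/fpsP=> n /=; rewrite add0r. Qed.
Fact fps_addN : left_inverse fps_zero fps_opp fps_add.
Proof. by move=> f; apply/fpsP=> n /=; rewrite addNr. Qed.

HB.instance Definition _ :=
  GRing.isZmodule.Build (fps R) fps_addA fps_addC fps_add0 fps_addN.

Lemma fps_coef0 n : (0 : fps R) n = 0. Proof. by []. Qed.
Lemma fps_coefN f n : (- f) n = - f n. Proof. by []. Qed.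
Lemma fps_coefD f g n : (f + g) n = f n + g n. Proof. by []. Qed.
Lemma fps_coefB f g n : (f - g) n = f n - g n. Proof. by []. Qed.
Lemma fps_coef_sum (I : Type) (r : seq I) (P : pred I) (F : I -> fps R) n :
  (\sum_(i <- r | P i) F i) n = \sum_(i <- r | P i) F i n.
Proof. by elim/big_rec2: _ => // i x y _ <-. Qed.
End FpsZmodule.

Section FpsRing.
Variable R : comNzRingType.
Implicit Types f g h : fps R.

Definition fpsC (c : R) : fps R := Fps (fun n => if n is 0 then c else 0).
Definition fps_mul f g : fps R :=
  Fps (fun n => \sum_(i < n.+1) f i * g (n - i)%N).

Let tr (m : nat) f : {poly R} := \poly_(i < m.+1) f i.

Let tr_coef m f n : (n <= m)%N -> (tr m f)`_n = f n.
Proof. by move=> nm; rewrite coef_poly ltnS nm. Qed.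

Let mul_tr m f g n : (n <= m)%N -> fps_mul f g n = (tr m f * tr m g)`_n.
Proof.
move=> nm; rewrite coefM; apply: eq_bigr => i _.
rewrite !tr_coef ?(leq_trans (leq_subr _ _) nm) //.
by rewrite (leq_trans _ nm) // -ltnS.
Qed.

Fact fps_mulC : commutative fps_mul.
Proof. by move=> f g; apply/fpsP=> n; rewrite !(@mul_tr n) // mulrC. Qed.

Fact fps_mulA : associative fps_mul.
Proof.
move=> f g h; apply/fpsP=> n.
have trM f1 g1 h1 : fps_mul f1 (fps_mul g1 h1) n
    = (tr n f1 * (tr n g1 * tr n h1))`_n.
  rewrite coefM; apply: eq_bigr => i _.
  by rewrite tr_coef -1?ltnS // (@mul_tr n (g1) h1 (n - i)%N (leq_subr _ _)).
by rewrite (fps_mulC (fps_mul f g) h) !trM mulrA [in RHS]mulrC.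
Qed.

Fact fps_mul1 : left_id (fpsC 1) fps_mul.
Proof.
move=> f; apply/fpsP=> n /=; rewrite big_ord_recl /= mul1r subn0.
by rewrite big1 ?addr0 // => i _; rewrite mul0r.
Qed.

Fact fps_mulDl : left_distributive fps_mul +%R.
Proof.
move=> f g h; apply/fpsP=> n /=.
by rewrite -big_split; apply: eq_bigr => i _; rewrite mulrDl.
Qed.

Fact fps_one_neq0 : fpsC 1 != 0 :> fps R.
Proof.
by apply/eqP=> /(congr1 (fun f : fps R => f 0%N)) /eqP; rewrite /= oner_eq0.
Qed.

HB.instance Definition _ := GRing.Zmodule_isComNzRing.Build (fps R)
  fps_mulA fps_mulC fps_mul1 fps_mulDl fps_one_neq0.

Lemma fps_coef1 n : (1 : fps R) n = (n == 0%N)%:R. Proof. by case: n. Qed.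
Lemma fps_coefM f g n : (f * g) n = \sum_(i < n.+1) f i * g (n - i)%N.
Proof. by []. Qed.
Lemma fps_coefCM c f n : (fpsC c * f) n = c * f n.
Proof.
rewrite fps_coefM big_ord_recl /= subn0 big1 ?addr0 // => i _.
by rewrite mul0r.
Qed.

Lemma fps_coefX_eq0 f n k : f 0%N = 0 -> (n < k)%N -> (f ^+ k) n = 0.
Proof.
move=> f0; elim: k n => // k IHk n nk; rewrite exprS fps_coefM big1 // => -[i /=].
rewrite ltnS => lein _; case: i lein => [|i] lein; first by rewrite f0 mul0r.
by rewrite IHk ?mulr0 // ltn_subLR // addSn ltnS (leq_trans _ (leq_addl _ _)).
Qed.

Definition fpsX : fps R := Fps (fun n => (n == 1%N)%:R).

End FpsRing.

Notation "''q'" := (fpsX _) (at level 0) : ring_scope.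

Section FpsUnitRing.
Variable R : comUnitRingType.
Implicit Types f g : fps R.

Definition fps_unit : {pred fps R} := fun f => f 0%N \is a GRing.unit.

(* 1/f = c^-1 * \sum_k (1 - c^-1 f)^k with c := f 0; terms with k > n do not
   contribute to the coefficient of q^n. *)
Definition fps_inv f : fps R :=
  if f \in fps_unit then
    Fps (fun n => (f 0%N)^-1 *
                  (\sum_(k < n.+1) (1 - fpsC (f 0%N)^-1 * f) ^+ k) n)
  else f.

Fact fps_mulV : {in fps_unit, left_inverse 1 fps_inv *%R}.
Proof.
move=> f fU; rewrite /fps_inv fU; set c := f 0%N; set u := 1 - _.
have cU : c \is a GRing.unit by [].
have u0 : u 0%N = 0 by rewrite fps_coefB fps_coefCM mulVr // subrr.
pose S m : fps R := \sum_(k < m) u ^+ k.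
have SE m n : (n < m)%N -> (S m) n = (S n.+1) n.
  move=> nm; rewrite /S !fps_coef_sum.
  rewrite (@big_ord_widen _ _ _ n.+1 m (fun k => (u ^+ k) n) nm) big_mkcond /=.
  symmetry; rewrite big_mkcond; apply: eq_bigr => k _.
  by case: ltnP => // nk; rewrite fps_coefX_eq0.
apply/fpsP=> n; rewrite fps_coefM.
transitivity (((fpsC c^-1 * S n.+1) * f) n).
  rewrite fps_coefM; apply: eq_bigr => i _ /=.
  by rewrite -[X in _ = X * _]/((fpsC c^-1 * S n.+1) i) fps_coefCM (SE n.+1 i).
rewrite mulrAC [_ * f](_ : _ = 1 - u); last by rewrite /u opprB addrC subrK.
rewrite -opprB mulNr -subrX1 opprB fps_coefB fps_coefX_eq0 ?ltnS //.
by rewrite subr0.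
Qed.

Fact fps_unitP f g : g * f = 1 -> f \in fps_unit.
Proof.
move=> /(congr1 (fun h : fps R => h 0%N)).
rewrite fps_coefM big_ord_recl big_ord0 addr0 /= => gf1.
by apply/unitrPr; exists (g 0%N); rewrite mulrC.
Qed.

Fact fps_invr_out : {in [predC fps_unit], fps_inv =1 id}.
Proof. by move=> f; rewrite /fps_inv inE => /negPf->. Qed.

HB.instance Definition _ := GRing.ComNzRing_hasMulInverse.Build (fps R)
  fps_mulV fps_unitP fps_invr_out.

End FpsUnitRing.

Definition fps_summable (R : zmodType) (I : choiceType) (A : set I)
    (F : I -> fps R) : Prop :=
  forall n, finite_set (A `&` [set i | F i n != 0]).

(* \sum_(i \in A) is 0 when infinitely many terms are nonzero, so this is
   meaningful only when fps_summable A F holds. *)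
Definition fps_sum (R : zmodType) (I : choiceType) (A : set I)
    (F : I -> fps R) : fps R :=
  Fps (fun n => \sum_(i \in A) F i n).

(* qpoch a n is (a; q)_n, with q the formal variable. *)
Definition qpoch (R : comNzRingType) (a : fps R) (n : nat) : fps R :=
  \prod_(j < n) (1 - a * 'q ^+ j).

Definition f4_term (n : nat) : fps int :=
  qpoch 'q (2 * n + 1)%N / qpoch (- 'q) (2 * n + 2)%N * 'q ^+ (n + 1)%N.

Definition f4 : fps int := fps_sum [set: nat] f4_term.

Lemma fps_coefMX_eq0 (R : comNzRingType) (f : fps R) n k :
  (n < k)%N -> (f * 'q ^+ k) n = 0.
Proof.
move=> nk; rewrite fps_coefM big1 // => i _.
by rewrite fps_coefX_eq0 ?mulr0 // (leq_ltn_trans (leq_subr _ _)).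
Qed.

Lemma qpochNq_unit n : qpoch (- 'q : fps int) n \is a GRing.unit.
Proof.
apply: rpred_prod => j _; rewrite -[_ \in _]/((1 - - 'q * 'q ^+ j : fps int) 0%N \is a GRing.unit).
by rewrite fps_coefB mulNr -exprS fps_coefN fps_coefX_eq0 // oppr0 subr0.
Qed.

Lemma f4_summable : fps_summable [set: nat] f4_term.
Proof.
move=> n; apply: (@sub_finite_set _ _ `I_n) => // i [_ Fi].
change (i < n)%N; apply: contraNT Fi; rewrite -leqNgt => ni.
by rewrite fps_coefMX_eq0 // addn1 ltnS.
Qed.

Section RingOfIntegers.
Variable K : fieldExtType rat.

Definition integral_pred : {pred K} :=
  fun x => `[< integralOver (intr : int -> K) x >].

Fact integral_subring : subring_closed integral_pred.
Proof.
split=> [|x y /asboolP xI /asboolP yI|x y /asboolP xI /asboolP yI]; apply/asboolP.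
- exact: integral1.
- exact: integral_sub.
- exact: integral_mul.
Qed.

HB.instance Definition _ := GRing.isSubringClosed.Build K integral_pred
  integral_subring.

Record ring_of_integers : Type := RingOfIntegers {
  roi_val : K; roi_valP : roi_val \in integral_pred }.

HB.instance Definition _ := [isSub for roi_val].
HB.instance Definition _ := [Choice of ring_of_integers by <:].
HB.instance Definition _ :=
  [SubChoice_isSubComNzRing of ring_of_integers by <:].

End RingOfIntegers.

(* MathComp's idealr structure only covers proper ideals. *)
Definition is_ideal (A : comNzRingType) (a : set A) : Prop :=
  [/\ a 0, forall x y, a x -> a y -> a (x + y)
    & forall r x, a x -> a (r * x)].

Definition nonzero_ideals (A : comNzRingType) : set (set A) :=
  [set a | is_ideal a /\ a <> [set 0]].
Arguments nonzero_ideals : clear implicits.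

Definition cosets (A : comNzRingType) (a : set A) : set (set A) :=
  range (fun x => [set x + y | y in a]).

(* |A/a|, with value 0 when A/a is infinite. *)
Definition ideal_norm (A : comNzRingType) (a : set A) : nat :=
  #|` fset_set (cosets a)|.

Definition is_Qsqrt2 (K : fieldExtType rat) : Prop :=
  exists2 s : K, s ^+ 2 = 2 & <<1; s>>%VS = fullv.

Lemma is_Qsqrt2_exists : exists K : fieldExtType rat, is_Qsqrt2 K.
Proof.
pose p : {poly rat} := 'X^2 - 2%:P.
have sp : size p = 3 by rewrite size_XnsubC.
have irr_p : irreducible_poly p.
  apply: cubic_irreducible; first by rewrite sp.
  move=> x; rewrite rootE !hornerE subr_eq0; apply/negP => /eqP x2.
  have e : numq x ^+ 2 = 2%:Z * denq x ^+ 2.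
    by apply: (@intr_inj rat); rewrite [in RHS]intrM !rmorphXn /= numqE exprMn x2.
  move: e => /(congr1 absz); rewrite abszM !abszX => e.
  have dn0 : (0 < `|denq x|)%N by rewrite absz_gt0 denq_neq0.
  have /(congr1 (logn 2)) := e => {e}.
  rewrite lognM ?expn_gt0 ?dn0 // !lognX.
  by move=> /(congr1 odd); rewrite oddD !oddM.
have [L _ [z zp zL]] := irredp_FAdjoin irr_p.
exists L; exists z => //; apply/eqP.
move: zp; rewrite rootE rmorphB /= map_polyXn map_polyC /= !hornerE subr_eq0.
by rewrite scaler_nat.
Qed.

(* Main.v *)
Require Import Defs.
From mathcomp Require Import all_boot all_order all_algebra all_field.
From mathcomp Require Import finmap all_classical.
From mathcomp Require Import ring zify.

(** Both sides of the identity count the points of a cone in Z^2 according to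
    the values of the indefinite form 2 y^2 - x^2.

    On the arithmetic side, O_K = Z[sqrt 2] is Euclidean for the norm, hence
    principal.  The unit 1 + sqrt 2 has norm -1, so a nonzero ideal has generators
    x + y sqrt 2 of negative norm, and the powers of 3 + 2 sqrt 2 and the sign
    single out exactly one of them in the cone -y < x <= y, y >= 1
    (cone_ideal_bij).  The norm of the ideal is then 2 y^2 - x^2
    (card_cosets_pideal), which has the parity of x.  Hence
    - \sum_a (-1)^N(a) q^N(a)
      = - \sum_(y >= 1) q^(2 y^2) \sum_(-y < x <= y) (-1)^x q^(- x^2),
    that is, \sum_(y >= 1) q^(y^2) b_y with
    b_y = - \sum_(-y < x <= y) (-1)^x q^(y^2 - x^2).

    On the side of q-series, f_4 = \sum_(m >= 1) q^m (q)_(2m - 1) / (-q)_(2m).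
    Two facts transform it:
    - 1 / (-q)_(2m) is the sum over y <= m of
      (1 - q^(2y)) q^(y^2 - y) b_y / ((q^2; q^2)_(m - y) (q^2; q^2)_(m + y))
      for m >= 1, which is a Bailey pair in base q^2 (bailey_pair);
    - the sum over m >= y of
      (1 - q^(2y)) q^(m - y) (q)_(2m - 1) / ((q^2; q^2)_(m - y) (q^2; q^2)_(m + y))
      is 1 for y >= 1, a case of the q-Gauss theorem (gauss_sum_mod).
    Inserting the first in f_4 and exchanging the two sums leaves
    \sum_(y >= 1) q^(y^2) b_y by the second.  Each of the two facts is proved by
    telescoping; all sums are kept finite, and convergence becomes divisibility
    of the error by a power of q (f4_coef). *)

Set Implicit Arguments.
Unset Strict Implicit.
Unset Printing Implicit Defensive.

Import Order.TTheory GRing.Theory Num.Theory.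
Local Open Scope ring_scope.

(** * The series f_4 as a sum over a cone *)

Section ConeSeries.

Local Notation X := (fpsX int : fps int).

(** The reciprocal 1/(q^2; q^2)_n. *)
Definition invpoch (n : nat) : fps int := (\prod_(k < n) (1 - X ^+ (2 * k).+2))^-1.

Lemma fps_unit_const1 (f : fps int) : f 0%N = 1 -> f \is a GRing.unit.
Proof. by move=> f0; rewrite -[_ \in _]/(f 0%N \is a GRing.unit) f0 unitr1. Qed.

Lemma unit_1BX n : 1 - X ^+ n.+1 \is a GRing.unit.
Proof. by apply: fps_unit_const1; rewrite fps_coefB fps_coefX_eq0 // subr0. Qed.

Lemma invpochS n : invpoch n = invpoch n.+1 * (1 - X ^+ (2 * n).+2).
Proof.
rewrite /invpoch big_ord_recr /= invrM ?unit_1BX //; last first.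
  by apply: rpred_prod => k _; apply: unit_1BX.
by rewrite mulrAC mulVr ?unit_1BX // mul1r.
Qed.

Lemma invpoch0 : invpoch 0 = 1.
Proof. by rewrite /invpoch big_ord0 invr1. Qed.

(** The polynomial b_y = - \sum_(-y < x <= y) (-1)^x q^(y^2 - x^2), encoded by
    its recurrence in y: passing from y to y + 1 multiplies the old terms by
    q^(2y + 1) and adds the two new terms x = y + 1 and x = - y.  The closed form
    is cone_polyE. *)
Fixpoint cone_poly (y : nat) : fps int :=
  if y is y'.+1 then
    X ^+ (2 * y').+1 * cone_poly y' + (-1) ^+ y' * (1 - X ^+ (2 * y').+1)
  else 0.

Arguments cone_poly : simpl never.

Lemma cone_polyS y : cone_poly y.+1 =
  X ^+ (2 * y).+1 * cone_poly y + (-1) ^+ y * (1 - X ^+ (2 * y).+1).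
Proof. by []. Qed.

(** Up to a constant, the alpha-side of a Bailey pair in base q^2 relative to q^4,
    with index shifted by one; at y = 0 the first factor makes it vanish. *)
Definition bailey_alpha (y : nat) : fps int :=
  (1 - X ^+ (2 * y)) * X ^+ (y * y.-1) * cone_poly y.

(** Creative telescoping for the ratio of two consecutive beta's.  With
    m = n + 1 and b_y read as a partial sum over the cone, the bracket times
    (1 - q^(2y)) q^(y^2 - y) is a difference in y, and after summation by parts
    the increments of b_y leave a summand that is again a difference once
    multiplied by 1 - q^(2n).  The right-hand side collects the two boundary
    terms, so the identity is checked by induction on the last index Y.  Writing
    n = Y + k avoids truncated subtraction. *)
Lemma bailey_partial k Y :
  let n := (Y + k)%N in
  (1 - X ^+ (2 * n)) * (\sum_(y < Y.+1) bailey_alpha y *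
     ((1 + X ^+ (2 * n).+1) * (1 + X ^+ (2 * n).+2) * invpoch (n.+1 - y)
       * invpoch (n.+1 + y)
      - invpoch (n - y) * invpoch (n + y))) =
  - (1 - X ^+ (2 * n)) * X ^+ (2 * n).+1 * X ^+ (Y.+1 * Y) * (1 + X ^+ (2 * Y).+1)
     * cone_poly Y * invpoch k * invpoch (n + Y).+1
  - (-1) ^+ Y * X ^+ (2 * n) * X ^+ (Y * Y.-1) * (1 - X ^+ (2 * Y))
     * invpoch k * invpoch (n + Y).
Proof.
elim: Y k => [|Y IH] k n.
  by rewrite big_ord1 /bailey_alpha /cone_poly /= muln0 !expr0 subrr !(mul0r, mulr0)
    subrr.
(* Everything becomes a polynomial identity in q, q^Y, q^k, q^(Y(Y-1)), b_Y, the
   sign and the two reciprocals of largest index. *)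
rewrite big_ord_recr /= mulrDr.
have := IH k.+1; rewrite /= addnS -addSn -/n => ->.
rewrite /bailey_alpha /= cone_polyS.
have -> : (n.+1 - Y.+1 = k.+1)%N by rewrite /n; lia.
have -> : (n - Y.+1 = k)%N by rewrite /n; lia.
rewrite !(addnS, addSn) (invpochS k) (invpochS (n + Y).+1) (invpochS (n + Y)).
set r1 := invpoch _; set r2 := invpoch _; set b := cone_poly Y.
have -> : (Y.+2 * Y.+1 = Y * Y.-1 + 4 * Y + 2)%N by nia.
have -> : (Y.+1 * Y = Y * Y.-1 + 2 * Y)%N by nia.
rewrite (invpochS (n + Y).+1) -/r2.
have -> : ((2 * (n + Y).+1).+2 = 4 * Y + 2 * k + 6)%N by rewrite /n; lia.
have -> : ((2 * (n + Y)).+2 = 4 * Y + 2 * k + 4)%N by rewrite /n; lia.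
have -> : (2 * n = 2 * Y + 2 * k + 2)%N by rewrite /n; lia.
have -> : (2 * Y.+1 = 2 * Y + 2)%N by lia.
rewrite !(exprS, exprD) !expr0.
set w := X ^+ Y; set v := X ^+ k; set g := X ^+ (Y * Y.-1); set s := (-1) ^+ Y.
move: (fpsX int : fps int) w v g s b r1 r2 => q w v g s b r1 r2.
ring.
Qed.

(** The beta-side of the pair; bailey_pair identifies it as 1/(-q)_(2n). *)
Definition bailey_beta n :=
  \sum_(y < n.+1) bailey_alpha y * invpoch (n - y) * invpoch (n + y).

Lemma qpochXS n : qpoch X n.+1 = qpoch X n * (1 - X ^+ n.+1).
Proof. by rewrite /qpoch big_ord_recr /= exprS. Qed.

Lemma qpochNXS n : qpoch (- X) n.+1 = qpoch (- X) n * (1 + X ^+ n.+1).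
Proof. by rewrite /qpoch big_ord_recr /= mulNr opprK exprS. Qed.

(** The boundary terms left by bailey_partial at Y = n + 1 cancel the term
    y = n + 2, which occurs in the larger beta only; the factor 1 - q^(2n + 2)
    by which everything was multiplied is a unit. *)
Lemma bailey_betaS n :
  (1 + X ^+ (2 * n.+1).+1) * (1 + X ^+ (2 * n.+1).+2) * bailey_beta n.+2
    = bailey_beta n.+1.
Proof.
apply/eqP; rewrite -subr_eq0; apply/eqP.
apply: (mulrI (unit_1BX (2 * n).+1)); rewrite mulr0.
have e2 : ((2 * n).+2 = 2 * n.+1)%N by lia.
have split_top (a : fps int) : a * bailey_beta n.+2 - bailey_beta n.+1 =
    \sum_(y < n.+2) bailey_alpha y * (a * invpoch (n.+2 - y) * invpoch (n.+2 + y)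
      - invpoch (n.+1 - y) * invpoch (n.+1 + y))
    + a * (bailey_alpha n.+2 * invpoch (n.+2 - n.+2) * invpoch (n.+2 + n.+2)).
  rewrite /bailey_beta big_ord_recr /= mulrDr addrAC; congr (_ + _).
  by rewrite mulr_sumr -sumrB; apply: eq_bigr => y _; ring.
rewrite split_top e2 mulrDr.
have := bailey_partial 0 n.+1; rewrite /= addn0 => ->.
rewrite subnn /bailey_alpha /= (cone_polyS n.+1) invpoch0 !(addnS, addSn).
rewrite !(invpochS (n + n).+2) (invpochS (n + n).+3).
set r := invpoch _; set b := cone_poly _.
have -> : ((2 * (n + n).+3).+2 = 4 * n + 8)%N by lia.
have -> : ((2 * (n + n).+2).+2 = 4 * n + 6)%N by lia.
have -> : (n.+2 * n.+1 = n.+1 * n + 2 * n + 2)%N by nia.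
have -> : (2 * n.+2 = 2 * n + 4)%N by lia.
have -> : (2 * n.+1 = 2 * n + 2)%N by lia.
rewrite !(exprS, exprD) !expr0.
ring.
Qed.

Lemma bailey_pair n : bailey_beta n.+1 * qpoch (- X) (2 * n.+1) = 1.
Proof.
elim: n => [|n IH].
  rewrite /bailey_beta !big_ord_recl big_ord0 /bailey_alpha /cone_poly /= !muln1 /qpoch.
  rewrite !big_ord_recl big_ord0 /= muln0 subrr mul0r !mul0r add0r invpoch0.
  rewrite -[RHS]invpoch0 (invpochS 0) (invpochS 1) /bump /=.
  rewrite !(muln0, muln1, addn0, add1n, addn1) !(exprS, expr0) /=; ring.
rewrite -[RHS]IH -(bailey_betaS n).
have -> : (2 * n.+2 = (2 * n.+1).+2)%N by lia.
by rewrite !qpochNXS; ring.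
Qed.

(** The first K terms of
    \sum_(m >= y + 1) (1 - q^(2y + 2)) q^(m - y - 1) (q)_(2m - 1)
       / ((q^2; q^2)_(m - y - 1) (q^2; q^2)_(m + y + 1)),
    with m = y + 1 + i.  The q-Gauss theorem evaluates the full series to 1. *)
Definition gauss_sum y K : fps int := (1 - X ^+ (2 * y).+2) * \sum_(i < K)
  X ^+ i * qpoch X (2 * (y + i)).+1 * invpoch i * invpoch (i + 2 * y).+2.

Lemma gauss_sumSr y K : gauss_sum y K.+1 = gauss_sum y K
  + (1 - X ^+ (2 * y).+2)
    * (X ^+ K * qpoch X (2 * (y + K)).+1 * invpoch K * invpoch (K + 2 * y).+2).
Proof. by rewrite /gauss_sum big_ord_recr /= mulrDr. Qed.

(** For y = 0 the summand is itself a difference in the summation index. *)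
Lemma gauss_sum_0l K : gauss_sum 0 K =
  1 - (1 + X) * X ^+ K * qpoch X (2 * K).+1 * invpoch K * invpoch K.+1.
Proof.
elim: K => [|K IH].
  rewrite /gauss_sum big_ord0 mulr0 muln0 qpochXS /qpoch big_ord0 invpoch0.
  rewrite -[Y in Y - _]invpoch0 (invpochS 0).
  rewrite !(muln0) !(exprS, expr0); ring.
rewrite gauss_sumSr IH !add0n muln0 addn0 (invpochS K) (invpochS K.+1).
have -> : (2 * K.+1 = (2 * K).+2)%N by lia.
rewrite !(qpochXS (2 * K).+1, qpochXS (2 * K).+2).
rewrite !(exprS, exprD) !expr0; ring.
Qed.

(** The summands for y + 1 and y differ by a difference in the summation index
    (a Wilf-Zeilberger pair), so the two partial sums differ by one boundary
    term.  One more term on the right keeps the same last value of m. *)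
Lemma gauss_sumSl y K : gauss_sum y.+1 K = gauss_sum y K.+1 -
  (1 + X ^+ (2 * y).+3)
    * X ^+ K * qpoch X (2 * (y + K)).+3 * invpoch K * invpoch (2 * y + K).+3.
Proof.
elim: K => [|K IH].
  rewrite gauss_sumSr /gauss_sum !big_ord0 !mulr0 !addn0 add0r !add0n expr0 !mul1r
    invpoch0.
  rewrite !(qpochXS (2 * y).+1, qpochXS (2 * y).+2) (invpochS (2 * y).+2).
  have -> : ((2 * (2 * y).+2).+2 = 4 * y + 6)%N by lia.
  rewrite !(exprS, exprD) !expr0; ring.
rewrite gauss_sumSr IH (gauss_sumSr y K.+1).
have -> : ((2 * y.+1) = (2 * y).+2)%N by lia.
rewrite !(addnS, addSn) (addnC K (2 * y)) (invpochS K) (invpochS (2 * y + K).+3).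
have -> : (2 * (y + K).+1 = (2 * (y + K)).+2)%N by lia.
rewrite !(qpochXS (2 * (y + K)).+3, qpochXS (2 * (y + K)).+4).
have -> : ((2 * (2 * y + K).+3).+2 = 4 * y + 2 * K + 8)%N by lia.
set r1 := invpoch _; set r2 := invpoch _; set p := qpoch _ _.
rewrite !(exprS, exprD) !expr0; ring.
Qed.

(** The series equals 1, in quantitative form: every boundary term produced
    by the two previous lemmas carries the factor q^K. *)
Lemma gauss_sum_mod y K : exists g, gauss_sum y K = 1 + g * X ^+ K.
Proof.
elim: y K => [|y IH] K.
  rewrite gauss_sum_0l; set b := qpoch _ _; set c := invpoch _; set d := invpoch _.
  exists (- (1 + X) * b * c * d); ring.
case: (IH K.+1) => g e; rewrite gauss_sumSl e exprS.
set a := 1 + X ^+ _; set b := qpoch _ _; set c := invpoch _; set d := invpoch _.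
exists (g * X - a * b * c * d); ring.
Qed.

Lemma f4_term_bailey m :
  f4_term m = \sum_(y < m.+1) X ^+ m.+1 * qpoch X (2 * m).+1
     * (bailey_alpha y.+1 * invpoch (m - y) * invpoch (m + y).+2).
Proof.
have bE : (qpoch (- X) (2 * m.+1))^-1 = bailey_beta m.+1.
  by rewrite -[LHS]mul1r -(bailey_pair m) mulrK // qpochNq_unit.
rewrite /f4_term; have -> : (2 * m + 2 = 2 * m.+1)%N by lia.
rewrite bE !addn1 -mulr_sumr.
have -> : bailey_beta m.+1
  = \sum_(y < m.+1) bailey_alpha y.+1 * invpoch (m - y) * invpoch (m + y).+2.
  rewrite /bailey_beta big_ord_recl {1}/bailey_alpha /= muln0 subrr !mul0r add0r.
  by apply: eq_bigr => y _; rewrite /bump /= add1n subSS addnS addSn.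
by rewrite [LHS]mulrC mulrA.
Qed.

(** Insert the Bailey pair in each term and exchange the two finite sums; the
    inner sum over the index of f_4 is the truncated Gauss sum. *)
Lemma f4_partial_sum M :
  \sum_(m < M) f4_term m
    = \sum_(y < M) X ^+ (y.+1 * y.+1) * cone_poly y.+1 * gauss_sum y (M - y).
Proof.
elim: M => [|M IH]; first by rewrite !big_ord0.
rewrite big_ord_recr /= IH f4_term_bailey [in LHS]big_ord_recr /=.
rewrite [in RHS]big_ord_recr /=.
rewrite addrA -big_split /=; congr (_ + _).
  apply: eq_bigr => y _; rewrite subSn ?(ltnW (ltn_ord y)) // gauss_sumSr.
  rewrite /bailey_alpha /=.
  rewrite subnKC ?(ltnW (ltn_ord y)) //.
  have -> : ((M - y + 2 * y).+2 = (M + y).+2)%N by have := ltn_ord y; lia.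
  have -> : ((2 * y).+2 = 2 * y.+1)%N by lia.
  have -> : X ^+ M.+1 = X ^+ (M - y) * X ^+ y.+1 by rewrite -exprD; congr (_ ^+ _);
    have := ltn_ord y; lia.
  by rewrite (mulnS y.+1 y) exprD; ring.
rewrite subSn // subnn gauss_sumSr /gauss_sum big_ord0 mulr0 add0r addn0 add0n expr0
  /bailey_alpha /=.
have -> : ((M + M).+2 = (2 * M).+2)%N by lia.
have -> : (2 * M.+1 = (2 * M).+2)%N by lia.
by rewrite (mulnS M.+1 M) exprD; ring.
Qed.

(** The error of the truncated Gauss sum at y is divisible by q^(M - y), and
    its coefficient in the partial sum by q^((y + 1)^2), so only powers of q
    greater than M are affected. *)
Lemma f4_coef n M : (n <= M)%N ->
  f4 n = \sum_(y < M) (X ^+ (y.+1 * y.+1) * cone_poly y.+1 : fps int) n.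
Proof.
move=> nM; transitivity ((\sum_(m < M) f4_term m) n).
  rewrite fps_coef_sum /f4 /fps_sum /=.
  rewrite (fsbig_ord _ _ (fun m => f4_term m n)).
  apply/esym/fsbig_widen => // m [_ Mm].
  apply: (fps_coefMX_eq0 (qpoch X (2 * m + 1)%N / qpoch (- X) (2 * m + 2)%N)).
  by move/negP: Mm; rewrite -leqNgt addn1 ltnS; apply: leq_trans.
rewrite f4_partial_sum fps_coef_sum; apply: eq_bigr => y _.
case: (gauss_sum_mod y (M - y)) => g ->.
rewrite mulrDr mulr1 fps_coefD [X in _ + X](_ : _ = 0) ?addr0 //.
have -> : X ^+ (y.+1 * y.+1) * cone_poly y.+1 * (g * X ^+ (M - y))
  = cone_poly y.+1 * g * X ^+ (y.+1 * y.+1 + (M - y)) by rewrite exprD; ring.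
by apply: fps_coefMX_eq0; have := ltn_ord y; nia.
Qed.

(** Here y = i + 1 and x = j - i, so that x runs over -y < x <= y as j runs
    over 0 <= j < 2y, and y^2 - x^2 = (2i + 1 - j) (j + 1). *)
Lemma cone_polyE i : cone_poly i.+1 =
  \sum_(j < (2 * i).+2) (-1) ^+ (i + j).+1 * X ^+ (((2 * i).+1 - j) * j.+1).
Proof.
elim: i => [|i IH].
  by rewrite cone_polyS !big_ord_recl big_ord0 /cone_poly /= !(exprS, expr0)
    /bump /=; ring.
rewrite cone_polyS {}IH (_ : (2 * i.+1).+2 = (2 * i).+4)%N; last by lia.
rewrite [RHS]big_ord_recl /= [in RHS]big_ord_recr /= mulr_sumr.
set S := \sum_(_ < _) _; set S' := \sum_(_ < _) _.
have -> : S' = S.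
  apply: eq_bigr => j _; rewrite /bump /= add1n addnS addSn.
  have -> : (((2 * i.+1).+1 - j.+1) * j.+2 = (2 * i.+1).+1 + ((2 * i).+1 - j) * j.+1)%N.
    by have := ltn_ord j; nia.
  by rewrite exprD !(exprS (-1)); ring.
have -> : ((2 * i.+1).+1 - bump 0 (2 * i).+2 = 0)%N by rewrite /bump /=; lia.
rewrite subn0 mul0n expr0 muln1 /bump /= add1n.
have -> : (i.+1 + (2 * i).+3 = i + 2 * i.+2)%N by lia.
rewrite (exprS _ (i + _)) exprD exprM sqrrN expr1n expr1n addn0 !exprS; ring.
Qed.

End ConeSeries.

(** * Ideals of Z[sqrt 2] and their norms *)

Lemma coset_eq (A : comNzRingType) (a : set A) (r r' : A) : is_ideal a ->
  [set r + y | y in a]%classic = [set r' + y | y in a]%classic <-> a (r - r').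
Proof.
case=> a0 aD aM; split=> [e|ar].
  have : [set r' + y | y in a]%classic r by rewrite -e; exists 0 => //; rewrite addr0.
  by case=> y ay <-; rewrite addrC addKr.
have aN x : a x -> a (- x) by move=> ax; rewrite -mulN1r; apply: (aM).
apply/seteqP; split=> _ [y ay <-].
  by exists (r - r' + y); [apply: aD | rewrite addrA subrKC].
exists (- (r - r') + y); first by apply: aD => //; apply: aN.
by rewrite opprB addrA subrKC.
Qed.

(** A complete invariant k of the cosets, with a section t, counts them. *)
Lemma card_cosets (A : comNzRingType) (a : set A) (N : nat)
    (k : A -> nat) (t : nat -> A) :
  is_ideal a -> (forall r, (k r < N)%N) -> (forall i, (i < N)%N -> k (t i) = i) ->
  (forall r r', k r = k r' <-> a (r - r')) -> (cosets a #= `I_N)%card.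
Proof.
move=> ia kN tK kP; rewrite card_eq_sym; apply/card_set_bijP.
exists (fun i => [set t i + y | y in a]%classic); split.
- by move=> i _; exists (t i).
- move=> i j; rewrite !inE => iN jN /(coset_eq _ _ ia) /kP.
  by rewrite !tK.
- move=> _ [r _ <-]; exists (k r); first exact: kN.
  by apply/(coset_eq _ _ ia)/kP; rewrite tK.
Qed.

(** A concrete model of Z[sqrt 2]: s is a square root of 2 and (1, s) is a
    Z-basis.  The ideals are counted from this property alone. *)
Definition is_Zsqrt2 (A : comNzRingType) (s : A) : Prop :=
  [/\ s ^+ 2 = 2, forall r, exists x y : int, r = x%:~R + y%:~R * s
    & forall x y : int, x%:~R + y%:~R * s = 0 -> x = 0 /\ y = 0].

(** Compare the parities of the exponent of 2 on both sides. *)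
Lemma sqr_eq_double_sqr (x y : int) : x ^+ 2 = 2 * y ^+ 2 -> x = 0 /\ y = 0.
Proof.
move=> e; suff y0 : y = 0 by split=> //; move: e; rewrite y0 expr0n mulr0 => /eqP;
  rewrite sqrf_eq0 => /eqP.
apply/eqP; apply: contraT; rewrite -absz_gt0 => yp.
have : (`|x| ^ 2 = 2 * `|y| ^ 2)%N by move: (congr1 absz e); rewrite abszM !abszX.
move=> /(congr1 (logn 2)); rewrite lognM ?expn_gt0 ?yp // !lognX.
by move=> /(congr1 odd); rewrite oddD !oddM.
Qed.

Definition nrm (x y : int) : int := x ^+ 2 - 2 * y ^+ 2.

Lemma nrm_eq0 x y : nrm x y = 0 -> x = 0 /\ y = 0.
Proof. by move/eqP; rewrite subr_eq0 => /eqP /sqr_eq_double_sqr. Qed.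

Lemma nrmM x y u v : nrm (x * u + 2 * y * v) (x * v + y * u) = nrm x y * nrm u v.
Proof. by rewrite /nrm; ring. Qed.

Section Zsqrt2.
Variables (A : comNzRingType) (s : A).
Hypothesis hA : is_Zsqrt2 s.

Definition zs (x y : int) : A := x%:~R + y%:~R * s.

Lemma zs_ex r : exists x y, r = zs x y. Proof. by case: hA => _ h _; apply: h. Qed.

Lemma zsB x y u v : zs x y - zs u v = zs (x - u) (y - v).
Proof. by rewrite /zs !rmorphB /=; ring. Qed.

Lemma zsM x y u v : zs x y * zs u v = zs (x * u + 2 * y * v) (x * v + y * u).
Proof.
case: hA => s2 _ _; rewrite /zs.
transitivity (x%:~R * u%:~R + (x%:~R * v%:~R + y%:~R * u%:~R) * s
  + y%:~R * v%:~R * s ^+ 2); first by ring.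
by rewrite s2 !(rmorphD, rmorphM) /=; ring.
Qed.

Lemma zs_eq x y u v : zs x y = zs u v <-> x = u /\ y = v.
Proof.
split=> [/eqP|[-> ->] //]; rewrite -subr_eq0 zsB => /eqP.
case: hA => _ _ h /h [/eqP + /eqP]; rewrite !subr_eq0 => /eqP -> /eqP -> //.
Qed.

Lemma zs00 : zs 0 0 = 0. Proof. by rewrite /zs mul0r addr0. Qed.
Lemma zs10 : zs 1 0 = 1. Proof. by rewrite /zs mul0r addr0. Qed.

Definition pideal (a : A) : set A := range (fun r => r * a).

Lemma pideal_ideal a : is_ideal (pideal a).
Proof.
split; first by exists 0; rewrite // mul0r.
- by move=> _ _ [r _ <-] [r' _ <-]; exists (r + r'); rewrite // mulrDl.
- by move=> r _ [r' _ <-]; exists (r * r'); rewrite // mulrA.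
Qed.

Lemma zs_coord : exists f : A -> int * int,
  (forall r, r = zs (f r).1 (f r).2) /\ forall x y, f (zs x y) = (x, y).
Proof.
have /choice [f fE] : forall r, exists p : int * int, r = zs p.1 p.2.
  by move=> r; have [x [y ->]] := zs_ex r; exists (x, y).
exists f; split=> // x y; have /zs_eq [] := fE (zs x y).
by case: (f _) => a b /= -> ->.
Qed.

(** The index of the lattice spanned by g (b + s) and g n, which is given in
    Hermite normal form: an element u + v s is determined modulo the lattice by
    v modulo g, and then by u, corrected by the multiple of g (b + s) that
    reduces v, modulo g n. *)
Lemma card_cosets_hnf (a : set A) (g n : nat) (b : int) :
  (0 < g)%N -> (0 < n)%N -> is_ideal a ->
  (forall u v, a (zs u v) <-> exists w k,
    v = g%:Z * w /\ u = g%:Z * (b * w + n%:Z * k)) ->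
  (cosets a #= `I_(g * g * n))%card.
Proof.
move=> g0 n0 ia aP; have [f [fE fK]] := zs_coord.
pose w r := ((f r).2 %/ g)%Z; pose i r := (((f r).1 - g%:Z * b * w r) %% (g * n)%N)%Z.
pose j r := ((f r).2 %% g)%Z.
have gz : (g%:Z != 0) by lia.
have gnz : ((g * n)%N%:Z != 0) by nia.
have i0 r : 0 <= i r < (g * n)%N.
  by rewrite modz_ge0 //= (lt_le_trans (ltz_mod _ gnz)) //; lia.
have j0 r : 0 <= j r < g.
  by rewrite modz_ge0 //= (lt_le_trans (ltz_mod _ gz)) //; lia.
apply: (@card_cosets _ _ _ (fun r => `|i r| * g + `|j r|)%N
  (fun m => zs (m %/ g)%N (m %% g)%N)) => //.
- by move=> r; have := i0 r; have := j0 r; nia.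
- move=> m mN; rewrite /i /j /w fK /=.
  have -> : ((m %% g)%N %/ g)%Z = 0 by rewrite divz_nat divn_small // ltn_mod.
  rewrite mulr0 subr0 !modz_nat modn_mod !absz_nat modn_small -?divn_eq //.
  by rewrite ltn_divLR // mulnAC.
- move=> r r'; rewrite [in a _](fE r) [in a _](fE r') zsB aP.
  have ri := divz_eq ((f r).1 - g%:Z * b * w r) (g * n)%N.
  have ri' := divz_eq ((f r').1 - g%:Z * b * w r') (g * n)%N.
  have rj := divz_eq (f r).2 g; have rj' := divz_eq (f r').2 g.
  rewrite -/(i r) -/(i r') -/(j r) -/(j r') -/(w r) -/(w r') in ri ri' rj rj'.
  set p := (_ %/ _)%Z in ri; set p' := (_ %/ _)%Z in ri'.
  split=> [e|[x [k [e1 e2]]]].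
    have [ei ej] : i r = i r' /\ j r = j r'.
      have := i0 r; have := j0 r; have := i0 r'; have := j0 r'.
      move: (i r) (i r') (j r) (j r') e => {ri ri' rj rj'} a1 a2 b1 b2 e h1 h2 h3 h4.
      have : (`|a1| = `|a2|)%N /\ (`|b1| = `|b2|)%N.
        have hb1 : (`|b1| < g)%N by lia.
        have hb2 : (`|b2| < g)%N by lia.
        split.
          by move: (congr1 (divn^~ g) e); rewrite !divnMDl // !divn_small // !addn0.
        by move: (congr1 (modn^~ g) e); rewrite !modnMDl !modn_small.
      by lia.
    exists (w r - w r'), (p - p'); split; first by rewrite rj rj' ej; ring.
    have -> : (f r).1 = p * (g * n)%N + i r + g%:Z * b * w r by rewrite -ri; ring.
    have -> : (f r').1 = p' * (g * n)%N + i r' + g%:Z * b * w r' by rewrite -ri'; ring.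
    by rewrite ei PoszM; ring.
  have ej : j r = j r'.
    rewrite /j; apply/eqP; rewrite eqz_mod_dvd e1; exact: dvdz_mulr.
  have ew : w r = w r' + x.
    apply: (mulIf gz); move: e1; rewrite rj rj' ej mulrDl => e1;
      rewrite (mulrC x) -e1; ring.
  have ei : i r = i r'.
    rewrite /i; apply/eqP; rewrite eqz_mod_dvd ew.
    have -> : (f r).1 - g%:Z * b * (w r' + x) - ((f r').1 - g%:Z * b * w r')
      = ((f r).1 - (f r').1) - g%:Z * b * x by ring.
    rewrite e2 (_ : _ - _ = (g * n)%N%:Z * k) ?dvdz_mulr // PoszM; ring.
  by rewrite ei ej.
Qed.

(** The norm of a principal ideal is the absolute norm of its generator.  Write
    the generator as g (x' + y' s) with x' and y' coprime.  Then y' is invertible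
    modulo n = x'^2 - 2 y'^2, and u + v s lies in the ideal of x' + y' s exactly
    when u = (x' / y') v modulo n; this puts the ideal in the Hermite normal form
    of card_cosets_hnf, with index g^2 |n|. *)
Lemma card_cosets_pideal x y : nrm x y != 0 ->
  (cosets (pideal (zs x y)) #= `I_`|nrm x y|)%card.
Proof.
move=> n0; pose g := gcdn `|x| `|y|.
have g0 : (0 < g)%N.
  rewrite gcdn_gt0 !absz_gt0 -negb_and; apply/negP => /andP [/eqP ex /eqP ey].
  by move: n0; rewrite ex ey /nrm.
have [x' ex] : exists x', x = g%:Z * x'.
  have /dvdzP [x' ->] : (g%:Z %| x)%Z by rewrite dvdzE dvdn_gcdl.
  by exists x'; rewrite mulrC.
have [y' ey] : exists y', y = g%:Z * y'.
  have /dvdzP [y' ->] : (g%:Z %| y)%Z by rewrite dvdzE dvdn_gcdr.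
  by exists y'; rewrite mulrC.
have [[p q] /= bez] : exists uv : int * int, uv.1 * x' + uv.2 * y' = 1.
  apply/coprimezP; rewrite coprimezE /coprime -(eqn_pmul2l g0) muln_gcdr.
  by rewrite -[g in X in gcdn X _]absz_nat -[g in X in gcdn _ X]absz_nat -!abszM -ex
    -ey muln1.
(* The inverse of y' modulo n' = x'^2 - 2 y'^2, obtained by squaring the
   Bezout relation and replacing x'^2 by n' + 2 y'^2. *)
pose c := 2 * p ^+ 2 * y' + 2 * p * q * x' + q ^+ 2 * y'.
have cy : c * y' = 1 - p ^+ 2 * nrm x' y'.
  have : (p * x' + q * y') ^+ 2 = 1 by rewrite bez expr1n.
  by rewrite /c /nrm => bez2; rewrite -[X in X - _]bez2; ring.
have nE : nrm x y = g%:Z ^+ 2 * nrm x' y' by rewrite ex ey /nrm; ring.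
have n'0 : nrm x' y' != 0 by apply: contraNneq n0 => e; rewrite nE e mulr0.
have [e [e2 en]] : exists e : int, e * e = 1 /\ `|nrm x' y'|%N%:Z = e * nrm x' y'.
  case: (leP 0 (nrm x' y')) => h; first by exists 1; split; rewrite ?mul1r // gez0_abs.
  by exists (-1); split; rewrite ?mulN1r ?opprK // ltz0_abs.
have -> : `|nrm x y|%N = (g * g * `|nrm x' y'|)%N
  by rewrite nE abszM abszX absz_nat mulnn.
apply: (@card_cosets_hnf _ _ _ (c * x')) => //; first by rewrite absz_gt0.
  exact: pideal_ideal.
move=> u v; split.
  case=> r _; have [P [Q ->]] := zs_ex r; rewrite zsM => /zs_eq [<- <-].
  (* k is solved for by means of c y' = 1 - p^2 n' and x'^2 = n' + 2 y'^2. *)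
  exists (y' * P + x' * Q), (e * (p ^+ 2 * x' * P - c * Q + 2 * y' * Q * p ^+ 2)).
  split; rewrite ex ey; first by ring.
  rewrite en -[LHS]mul1r -[in LHS]e2.
  transitivity (g%:Z * ((c * y') * x' * P + c * Q * (nrm x' y' + 2 * y' ^+ 2)
    + e * e * nrm x' y' * (p ^+ 2 * x' * P - c * Q + 2 * y' * Q * p ^+ 2)));
      last by rewrite /nrm; ring.
  transitivity (g%:Z * ((c * y') * x' * P + c * Q * nrm x' y' + 2 * y' * Q * (c * y')
    + e * e * nrm x' y' * (p ^+ 2 * x' * P - c * Q + 2 * y' * Q * p ^+ 2)));
      last by ring.
  by rewrite cy e2; ring.
case=> w [k [-> ->]].
(* The quotient by the generator: multiply by the conjugate x' - y' s, then
   divide by n', again with c y' = 1 - p^2 n'. *)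
exists (zs (c * w - 2 * y' * p ^+ 2 * w + x' * (e * k))
  (p ^+ 2 * x' * w - y' * (e * k))) => //.
rewrite zsM; apply/zs_eq; rewrite ex ey en; split.
  transitivity (g%:Z * (c * x' * w + e * nrm x' y' * k)); last by ring.
  rewrite /nrm; ring.
transitivity (g%:Z * w * (c * y' + p ^+ 2 * nrm x' y')); first by rewrite /nrm; ring.
by rewrite cy; ring.
Qed.

Lemma ideal_norm_pideal x y : nrm x y != 0
  -> ideal_norm (pideal (zs x y)) = `|nrm x y|%N.
Proof. by move=> n0; apply/card_fset_set/card_cosets_pideal. Qed.

Lemma near_quotient (u n : int) : n != 0 -> exists k, 2 * `|u - k * n| <= `|n|.
Proof.
move=> n0; have := divz_eq u n; have := modz_ge0 u n0; have := ltz_mod u n0.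
set k := (u %/ n)%Z; set r := (u %% n)%Z => rn r0 e.
case: (leP (2 * r) `|n|) => h; first by exists k; rewrite e addrC addKr ger0_norm.
exists (k + sgz n).
have -> : u - (k + sgz n) * n = r - `|n| by rewrite -abszE abszEsg {1}e; ring.
by lia.
Qed.

(** Z[sqrt 2] is Euclidean for the norm: rounding both coordinates of a quotient
    leaves an error e + f s with |e|, |f| <= 1/2, whose norm e^2 - 2 f^2 is at
    most 1/2 in absolute value. *)
Lemma ideal_principal (a : set A) : nonzero_ideals A a ->
  exists x y, nrm x y != 0 /\ a = pideal (zs x y).
Proof.
case=> -[a0 aD aM] an0.
have [x [y [n0 axy]]] : exists x y, nrm x y != 0 /\ a (zs x y).
  apply: contrapT => H; apply: an0; apply/seteqP; split=> [r ar|_ ->] //=.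
  have [x [y er]] := zs_ex r; rewrite er in ar *.
  have [/eqP/nrm_eq0 [-> ->]|n0] := boolP (nrm x y == 0); first exact: zs00.
  by case: H; exists x, y.
have [m] := ubnP `|nrm x y|%N; elim: m => // m IH in x y n0 axy *; rewrite ltnS => nm.
have [[u [v [[uv0 auv] lt]]]|min] :=
  pselect (exists u v, (nrm u v != 0 /\ a (zs u v)) /\ (`|nrm u v| < `|nrm x y|)%N).
  exact: (IH u v uv0 auv (leq_trans lt nm)).
exists x, y; split=> //; apply/seteqP; split; last by move=> _ [r _ <-]; apply: (aM).
move=> r ar; have [u [v er]] := zs_ex r; rewrite er in ar *.
have [k hk] := near_quotient (u * x - 2 * v * y) n0.
have [l hl] := near_quotient (v * x - u * y) n0.
have ad : a (zs (u - (k * x + 2 * l * y)) (v - (k * y + l * x))).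
  rewrite -zsB; apply: aD => //; rewrite -mulN1r; apply: (aM).
  have <- : zs k l * zs x y = zs (k * x + 2 * l * y) (k * y + l * x) by rewrite zsM;
    congr zs; ring.
  exact: (aM).
set u' := u - _ in ad; set v' := v - _ in ad.
(* The remainder times the conjugate of x + y s is the rounding error. *)
have nE : nrm u' v' * nrm x y =
  (u * x - 2 * v * y - k * nrm x y) ^+ 2 - 2 * (v * x - u * y - l * nrm x y) ^+ 2.
  by rewrite /u' /v' /nrm; ring.
have lt : (`|nrm u' v'| < `|nrm x y|)%N.
  move: nE hk hl; move: (u * x - 2 * v * y - k * nrm x y) (v * x - u * y - l * nrm x y).
  move: (nrm u' v') (nrm x y) n0 => n' n n0 P Q nE hP hQ.
  have sq R : 2 * `|R| <= `|n| -> 4 * R ^+ 2 <= n ^+ 2.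
    move=> h; have : (2 * `|R|) ^+ 2 <= `|n| ^+ 2 by rewrite ler_sqr ?nnegrE ?mulr_ge0.
    by rewrite exprMn !real_normK ?num_real.
  have P2 := sq _ hP; have Q2 := sq _ hQ.
  have : 2 * `|n' * n| <= n ^+ 2.
    have := sqr_ge0 P; have := sqr_ge0 Q; rewrite nE; lia.
  rewrite -(real_normK (num_real n)) normrM expr2.
  have : 0 < `|n| by rewrite normr_gt0.
  rewrite -ltz_nat !abszE; move: `|n| `|n'| => b' a'; nia.
have : nrm u' v' = 0.
  by apply/eqP; apply: contraPT ad => h ad; apply: min; exists u', v'.
case/nrm_eq0 => eu ev; exists (zs k l) => //; rewrite zsM; apply/zs_eq; split.
  by move/eqP: eu; rewrite subr_eq0 => /eqP ->; ring.
by move/eqP: ev; rewrite subr_eq0 => /eqP ->; ring.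
Qed.

Lemma pideal_unitM (r r' a : A) : r' * r = 1 -> pideal (r * a) = pideal a.
Proof.
move=> rr; apply/seteqP; split=> _ [t _ <-]; first by exists (t * r); rewrite // mulrA.
by exists (t * r'); rewrite // -mulrA [r' * _]mulrA rr mul1r.
Qed.

(** A fundamental domain for the units acting on the elements of negative norm:
    3 + 2 s maps its boundary ray x = - y to the ray x = y, and - 1 exchanges
    the two half-planes y > 0 and y < 0. *)
Definition in_cone (x y : int) := (0 < y) && (- y < x <= y).

Lemma nrm_cone_lt0 x y : in_cone x y -> nrm x y < 0.
Proof. by rewrite /in_cone /nrm => h; nia. Qed.

(** The unit 1 + s of norm -1 makes the norm negative, the unit -1 makes y
    positive.  Outside of the cone, 3 + 2 s or 3 - 2 s then decreases y while
    keeping it positive, since 2 |x| < 3 y follows from x^2 < 2 y^2. *)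
Lemma cone_generator x y : nrm x y != 0 ->
  exists x' y', in_cone x' y' /\ pideal (zs x y) = pideal (zs x' y').
Proof.
move=> n0.
wlog n_lt0 : x y n0 / nrm x y < 0 => [H|].
  have [|n_ge0] := ltP (nrm x y) 0; first exact: H.
  have nN : nrm (x + 2 * y) (x + y) = - nrm x y by rewrite /nrm; ring.
  have [||x' [y' [c e]]] := H (x + 2 * y) (x + y);
    rewrite ?nN ?oppr_eq0 ?oppr_lt0 ?lt_def ?n0 //.
  exists x', y'; split=> //; rewrite -e.
  have -> : zs (x + 2 * y) (x + y) = zs 1 1 * zs x y by rewrite zsM; congr zs; ring.
  by rewrite (@pideal_unitM _ (zs (-1) 1)) // zsM -zs10; congr zs.
wlog y_gt0 : x y n0 n_lt0 / 0 < y => [H|].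
  have [|y_le0] := ltP 0 y; first exact: H.
  have nN : nrm (- x) (- y) = nrm x y by rewrite /nrm; ring.
  have y0 : y != 0 by apply: contraTneq n_lt0 => ->; rewrite /nrm; nia.
  have [|||x' [y' [c e]]] := H (- x) (- y); rewrite ?nN //; first by lia.
  exists x', y'; split=> //; rewrite -e.
  have -> : zs (- x) (- y) = zs (-1) 0 * zs x y by rewrite zsM; congr zs; ring.
  by rewrite (@pideal_unitM _ (zs (-1) 0)) // zsM -zs10; congr zs.
have [m] := ubnP `|y|%N; elim: m => // m IH in x y n0 n_lt0 y_gt0 * => ym.
have [c|] := boolP (in_cone x y); first by exists x, y.
rewrite /in_cone y_gt0 /= negb_and -!leNgt -ltNge => out.
have unitM e u v : e * e = 1 ->
  pideal (zs (3 * u - 4 * e * v) (3 * v - 2 * e * u)) = pideal (zs u v).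
  move=> e2.
  have -> : zs (3 * u - 4 * e * v) (3 * v - 2 * e * u) = zs 3 (- 2 * e) * zs u v.
    by rewrite zsM; congr zs; ring.
  rewrite (@pideal_unitM _ (zs 3 (2 * e))) // zsM -zs10; congr zs; last by ring.
  by transitivity (9 - 8 * (e * e)); [ring | rewrite e2].
(* On the ray x = - y, where y would not decrease, 3 + 2 s leads to (y, y). *)
have [->|x_neq] := eqVneq x (- y).
  exists y, y; split; first by rewrite /in_cone; lia.
  by rewrite -(unitM (-1)) //; congr (pideal (zs _ _)); ring.
have [e [e2 [y'_gt0 lt]]] : exists e : int,
    e * e = 1 /\ 0 < 3 * y - 2 * e * x /\ 3 * y - 2 * e * x < y.
  have yx : (2 * x) ^+ 2 < (3 * y) ^+ 2 by move: n_lt0; rewrite /nrm; nia.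
  case/orP: out => h; [exists (-1)|exists 1]; split=> //; split; try lia; nia.
have nE : nrm (3 * x - 4 * e * y) (3 * y - 2 * e * x) = nrm x y.
  transitivity (nrm x y + 8 * (e * e - 1) * (2 * y ^+ 2 - x ^+ 2));
    last by rewrite e2; ring.
  by rewrite /nrm; ring.
have [||||x' [y' [c eq]]] := IH (3 * x - 4 * e * y) (3 * y - 2 * e * x);
  rewrite ?nE //; first by lia.
by exists x', y'; split=> //; rewrite -eq unitM.
Qed.

(** If c + d s with d > 0 mapped a point of the cone to a point of the cone, the
    cone inequalities would force 3 d < 2 c; with c^2 = 1 + 2 d^2 this leaves
    d = 1 and c^2 = 3. *)
Lemma cone_unit_absurd c d x y : nrm c d = 1 -> 0 < d -> in_cone x y ->
  ~~ in_cone (c * x + 2 * d * y) (c * y + d * x).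
Proof.
rewrite /nrm /in_cone => n1 d0 /and3P [y0 x1 x2]; apply/negP => /and3P [y'0 x'1 x'2].
have c_gt_d : d < c.
  have : c < - d \/ d < c by nia.
  by case=> // cd; nia.
have cx : (c - d) * (- y) < (c - d) * x by rewrite ltr_pM2l ?subr_gt0.
have cd : 0 < (2 * c - 3 * d) * y by lia.
have cd' : 3 * d < 2 * c by move: cd; rewrite pmulr_lgt0 // subr_gt0.
have dd : 4 * (c ^+ 2) > 9 * d ^+ 2 by nia.
have d1 : d = 1.
  have d4 : d ^+ 2 < 2 ^+ 2 by lia.
  have : d < 2 by rewrite -ltr_sqr ?nnegrE // ltW.
  by lia.
have c3 : c ^+ 2 = 3 by rewrite d1 in n1; lia.
have [c1|c2] : c <= 1 \/ 2 <= c by lia.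
- by nia.
- by nia.
Qed.

(** Two generators in the cone differ by a unit p + q s; both have negative norm,
    so the unit has norm 1.  The sign of q is excluded by cone_unit_absurd,
    applied to the unit or to its inverse, and q = 0 leaves the unit 1. *)
Lemma cone_generator_uniq x y x' y' : in_cone x y -> in_cone x' y' ->
  pideal (zs x y) = pideal (zs x' y') -> x = x' /\ y = y'.
Proof.
move=> c c' e.
have [r _] : pideal (zs x y) (zs x' y') by rewrite e; exists 1; rewrite // mul1r.
have [r' _] : pideal (zs x' y') (zs x y) by rewrite -e; exists 1; rewrite // mul1r.
have [p [q ->]] := zs_ex r; have [p' [q' ->]] := zs_ex r'.
rewrite !zsM => /zs_eq [e1 e2] /zs_eq [e3 e4].
have n_lt0 := nrm_cone_lt0 c; have n'_lt0 := nrm_cone_lt0 c'.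
have nE : nrm x' y' = nrm p q * nrm x y by rewrite -nrmM e3 e4.
have nE' : nrm x y = nrm p' q' * nrm x' y' by rewrite -nrmM e1 e2.
have n1 : nrm p q = 1.
  have npq : 0 < nrm p q by move: n'_lt0; rewrite nE nmulr_llt0.
  have npq' : 0 < nrm p' q' by move: n_lt0; rewrite nE' nmulr_llt0.
  have : nrm p' q' * nrm p q = 1.
    have nz : nrm x y != 0 by rewrite lt_eqF.
    by apply: (mulIf nz); rewrite mul1r -mulrA -nE -nE'.
  by nia.
case: (ltgtP q 0) => q0.
- have := @cone_unit_absurd p (- q) x' y' _ _ c'.
  have -> : p * x' + 2 * - q * y' = nrm p q * x by rewrite -e3 -e4 /nrm; ring.
  have -> : p * y' + - q * x' = nrm p q * y by rewrite -e3 -e4 /nrm; ring.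
  rewrite n1 !mul1r c => H; suff: false by []; apply: H; last by lia.
  by rewrite -n1 /nrm; ring.
- have := cone_unit_absurd n1 q0 c.
  by rewrite e3 e4 c'.
move: c c' n1 e3 e4; rewrite q0 /nrm /in_cone => c c' n1 e3 e4.
have p1 : p = 1 \/ p = -1 by nia.
by case: p1 e3 e4 => ->; nia.
Qed.

(** The ideal generated by (j - i) + (i + 1) s, for p = (i, j): in these
    coordinates the cone is j < 2i + 2. *)
Definition cone_ideal (p : nat * nat) : set A :=
  pideal (zs (p.2%:Z - p.1%:Z) p.1.+1%:Z).

(** The value 2 y^2 - x^2 at y = i + 1 and x = j - i, written as
    y^2 + (y - x) (y + x) to stay within the natural numbers. *)
Definition cone_norm (p : nat * nat) : nat :=
  (p.1.+1 * p.1.+1 + ((2 * p.1).+1 - p.2) * p.2.+1)%N.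

Definition cone_index : set (nat * nat) := [set p | (p.2 < (2 * p.1).+2)%N]%classic.

Lemma in_cone_index p : cone_index p -> in_cone (p.2%:Z - p.1%:Z) p.1.+1%:Z.
Proof. by rewrite /cone_index /in_cone /=; lia. Qed.

Lemma ideal_norm_cone_ideal p : cone_index p -> ideal_norm (cone_ideal p) = cone_norm p.
Proof.
move=> /[dup] /in_cone_index /nrm_cone_lt0 n0 pC; rewrite ideal_norm_pideal ?lt_eqF //.
by move: pC n0; rewrite /cone_index /cone_norm /nrm /=; nia.
Qed.

(** Principality, existence and uniqueness of the generator in the cone. *)
Lemma cone_ideal_bij : set_bij cone_index (nonzero_ideals A) cone_ideal.
Proof.
split.
- move=> p /in_cone_index c; split; first exact: pideal_ideal.
  move=> e; have : cone_ideal p (zs (p.2%:Z - p.1%:Z) p.1.+1%:Z) by exists 1;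
    rewrite // mul1r.
  by rewrite e /= -zs00 => /zs_eq [].
- move=> [i j] [i' j']; rewrite !inE => /in_cone_index c /in_cone_index c' e.
  by have [/= e1 e2] := cone_generator_uniq c c' e; congr (_, _); lia.
- move=> a /ideal_principal [x [y [/cone_generator [x' [y' [c ->]]] ->]]].
  exists (absz (y' - 1), absz (x' + (y' - 1))); move: c; rewrite /in_cone => c.
    by rewrite /cone_index /=; lia.
  by rewrite /cone_ideal /=; congr (pideal (zs _ _)); lia.
Qed.

End Zsqrt2.

(** * The ring of integers of Q(sqrt 2) *)

Local Notation pZtoQ := (map_poly (intr : int -> rat)).

(** Gauss's lemma: up to a rational factor the divisor is an integer polynomial,
    whose leading coefficient must be a unit. *)
Lemma monic_dvd_rat_int (d : {poly rat}) (p : {poly int}) :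
  d \is monic -> p \is monic -> d %| pZtoQ p -> exists d' : {poly int}, d = pZtoQ d'.
Proof.
move=> dm pm /dvdpP_rat_int [d' [a a0 dE] [r pE]].
have ld : lead_coef d' * lead_coef r = 1 by rewrite -lead_coefM -pE (eqP pm).
have ad : a * (lead_coef d')%:~R = 1.
  have := eqP dm; rewrite dE lead_coefZ lead_coef_map_inj //; exact: intr_inj.
have [l1|l1] : lead_coef d' = 1 \/ lead_coef d' = -1.
  by move/(congr1 absz)/eqP: ld; rewrite abszM muln_eq1 => /andP [/eqP + _]; lia.
  by exists d'; rewrite dE; move: ad; rewrite l1 mulr1 => ->; rewrite scale1r.
exists (- d'); rewrite dE rmorphN /=; move: ad; rewrite l1 mulrN mulr1 => aN.
by rewrite -[a]opprK aN scaleN1r.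
Qed.

Lemma rat_root_int (p : {poly int}) (c : rat) :
  p \is monic -> root (pZtoQ p) c -> exists k : int, c = k%:~R.
Proof.
move=> pm; rewrite -dvdp_XsubCl => /(monic_dvd_rat_int (monicXsubC c) pm) [d' dE].
have dE0 : - c = (d'`_0)%:~R by rewrite -coef_map -dE coefB coefX coefC sub0r.
by exists (- d'`_0); rewrite rmorphN /= -dE0 opprK.
Qed.

Lemma rat_sqr_int (c : rat) (m : int) : c ^+ 2 = m%:~R -> exists k : int, c = k%:~R.
Proof.
move=> c2; apply: (@rat_root_int ('X^2 - m%:P)); first exact: monicXnsubC.
by rewrite rootE rmorphB /= map_polyXn map_polyC /= !hornerE c2 subrr.
Qed.

Section Qsqrt2.
Variables (K : fieldExtType rat) (s : K).
Hypotheses (s2 : s ^+ 2 = 2) (sK : <<1; s>>%VS = fullv).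

Lemma qs_eq0 (a b : rat) : a%:A + b *: s = 0 -> a = 0 /\ b = 0.
Proof.
move=> e; have b0 : b = 0.
  apply/eqP; apply: contraT => b0.
  have sE : s = (- (b^-1 * a))%:A.
    apply: (scalerI b0); rewrite scalerA mulrN mulVKf // scaleNr.
    by apply/eqP; rewrite -addr_eq0 addrC e.
  have q2 : (b^-1 * a) ^+ 2 = 2.
    apply: (fmorph_inj (in_alg K)); rewrite -sqrrN rmorphXn rmorph_nat.
    by move: s2; rewrite sE.
  move: (b^-1 * a) q2 => q q2.
  have : numq q ^+ 2 = 2 * denq q ^+ 2.
    by apply: (@intr_inj rat); rewrite [in RHS]intrM !rmorphXn /= numqE exprMn q2.
  by move/sqr_eq_double_sqr => [_ /eqP]; rewrite (negPf (denq_neq0 q)).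
split=> //; move: e; rewrite b0 scale0r addr0 => /eqP;
  rewrite scaler_eq0 oner_eq0 orbF => /eqP //.
Qed.

Lemma qs_ex (x : K) : exists a b : rat, x = a%:A + b *: s.
Proof.
have : x \in <<1; s>>%VS by rewrite sK memvf.
move/Fadjoin_polyP => [p /polyOver1P [q ->] ->].
exists (q %% ('X^2 - 2%:P))`_0, (q %% ('X^2 - 2%:P))`_1.
rewrite {1}(divp_eq q ('X^2 - 2%:P))
  rmorphD rmorphM /= rmorphB /= map_polyXn map_polyC /= !hornerE.
rewrite s2 scaler_nat subrr mulr0 add0r.
have : (size (q %% ('X^2 - 2%:P))%R <= 2)%N.
  by rewrite -ltnS -(size_XnsubC (2 : rat) (isT : 0 < 2)%N)
    ltn_modp -size_poly_eq0 size_XnsubC.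
set r := _ %% _ => rs.
rewrite (@horner_coef_wide _ 2) ?size_map_poly // !big_ord_recl big_ord0 !coef_map /=.
by rewrite expr0 mulr1 addr0 expr1 mulr_algl.
Qed.

Lemma qs_int (x y : int) : x%:~R + y%:~R * s \in integral_pred (K := K).
Proof.
have sI : s \in integral_pred (K := K).
  apply/asboolP; exists ('X^2 - 2%:P); first exact: monicXnsubC.
  by rewrite rootE rmorphB /= map_polyXn map_polyC /= !hornerE s2 subrr.
by rewrite rpredD ?rpredM // rpred_int.
Qed.

(** If b = 0, then a is a rational root of a monic integer polynomial.  Otherwise
    the minimal polynomial of a + b s is X^2 - 2a X + (a^2 - 2b^2), and
    Gauss's lemma makes t = 2a and n = a^2 - 2b^2 integers.  Then 4b is a rational
    number whose square 2 (t^2 - 4n) is an integer, hence it is an integer, and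
    reading this equation modulo powers of 2 shows that t is even and that 4b is
    divisible by 4. *)
Lemma integral_qs (a b : rat) : a%:A + b *: s \in integral_pred (K := K) ->
  exists x y : int, a = x%:~R /\ b = y%:~R.
Proof.
move=> /asboolP [p pm]; set z := _ + _ => pz.
have pzE : map_poly (intr : int -> K) p = map_poly (in_alg K) (pZtoQ p).
  by rewrite -map_poly_comp; apply: eq_map_poly => k;
    apply/esym/(rmorph_int (in_alg K)).
rewrite pzE in pz.
have [b0|b0] := eqVneq b 0.
  have [|x ax] := rat_root_int pm (c := a); last by exists x, 0.
  by move: pz; rewrite /z b0 scale0r addr0 -[a%:A]/(in_alg K a) fmorph_root.
pose d : {poly rat} := Poly [:: a ^+ 2 - 2 * b ^+ 2; - (2 * a); 1].
have dE : d = [:: a ^+ 2 - 2 * b ^+ 2; - (2 * a); 1] :> seq rat.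
  by rewrite (@PolyK _ 0) //= oner_neq0.
have sd : size d = 3%N by rewrite dE.
have dm : d \is monic by rewrite monicE lead_coefE dE.
have dz : (map_poly (in_alg K) d).[z] = 0.
  rewrite (@horner_coef_wide _ 3)
    ?size_map_poly ?sd // !big_ord_recl big_ord0 !coef_map /= dE /=.
  have gen (f : {rmorphism rat -> K}) : f (a ^+ 2 - 2 * b ^+ 2)
      + f (- (2 * a)) * (f a + f b * s) + (f a + f b * s) ^+ 2 = 0.
    rewrite !(rmorphB, rmorphN, rmorphM, rmorph1, rmorph_nat).
    transitivity (f b ^+ 2 * (s ^+ 2 - 2)); [ring | by rewrite s2 subrr mulr0].
  have -> : z = in_alg K a + in_alg K b * s by rewrite mulr_algl.
  rewrite /bump /= scale1r mul1r expr0 mulr1 addr0 !addn0 addrA;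
    exact: (gen (in_alg K)).
have dp : d %| pZtoQ p.
  apply/modp_eq0P/eqP; set r := _ %% _.
  have rs : (size r <= 2)%N by rewrite -ltnS -sd ltn_modp monic_neq0.
  have rz : (map_poly (in_alg K) r).[z] = 0.
    move: pz; rewrite {1}(divp_eq (pZtoQ p) d)
      rmorphD rmorphM /= rootE hornerD hornerM dz mulr0 add0r.
    by move/eqP.
  move: rz; rewrite (@horner_coef_wide _ 2)
    ?size_map_poly // !big_ord_recl big_ord0 !coef_map /=.
  rewrite expr0 mulr1 addr0 expr1 mulr_algl /z scalerDr addrA !scalerA -scalerDl.
  case/qs_eq0 => e /eqP; rewrite mulf_eq0 (negPf b0) orbF => /eqP r1.
  apply/eqP/polyP => -[|[|i]]; rewrite coef0 //.
    by move: e; rewrite r1 mul0r addr0.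
  by rewrite nth_default // (leq_trans rs).
have [d' dE'] := monic_dvd_rat_int dm pm dp.
have nE : (d'`_0)%:~R = a ^+ 2 - 2 * b ^+ 2 by rewrite -coef_map -dE' dE.
have tE : (- d'`_1)%:~R = 2 * a by rewrite rmorphN -coef_map -dE' dE opprK.
move: (- d'`_1) (d'`_0) tE nE => t n tE nE.
have even_sqr (k m : int) : k ^+ 2 = 2 * m -> exists l, k = 2 * l.
  move=> e; have := divz_eq k 2; have := modz_ge0 k (isT : 2%:Z != 0).
  have := ltz_mod k (isT : 2%:Z != 0) => r2 r0 ke.
  exists (k %/ 2)%Z; move: (k %/ 2)%Z (k %% 2)%Z r2 r0 ke e => l r r2 r0 ->.
  have [->|->] : r = 0 \/ r = 1 by lia.
    by rewrite addr0 mulrC.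
  by rewrite (_ : _ ^+ 2 = 2 * (2 * l ^+ 2 + 2 * l) + 1); [lia | ring].
have [k kE] : exists k : int, 4 * b = k%:~R.
  apply: (@rat_sqr_int _ (2 * t ^+ 2 - 8 * n)).
  by rewrite rmorphB !rmorphM /= tE nE; ring.
have kk : k ^+ 2 = 2 * (t ^+ 2 - 4 * n).
  apply: (@intr_inj rat); rewrite rmorphXn /= -kE rmorphM rmorphB !rmorphM /= tE nE;
    ring.
have [B kB] := even_sqr _ _ kk.
have BB : t ^+ 2 = 2 * (B ^+ 2 + 2 * n) by move: kk; rewrite kB; lia.
have [x tx] := even_sqr _ _ BB.
have xx : B ^+ 2 = 2 * (x ^+ 2 - n) by move: BB; rewrite tx; lia.
have [y By] := even_sqr _ _ xx.
exists x, y; split.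
  by apply: (mulfI (isT : (2 : rat) != 0)); rewrite -tE tx rmorphM.
by apply: (mulfI (isT : (4 : rat) != 0)); rewrite kE kB By !rmorphM /=; ring.
Qed.

Lemma ring_of_integers_Zsqrt2 : exists t : ring_of_integers K, is_Zsqrt2 t.
Proof.
have sI : s \in integral_pred (K := K).
  by have := qs_int 0 1; rewrite add0r mul1r.
pose t : ring_of_integers K := RingOfIntegers sI.
have valE (x y : int) : val (x%:~R + y%:~R * t) = x%:~R + y%:~R * s.
  by rewrite rmorphD rmorphM !rmorph_int.
exists t; split.
- by apply: val_inj; rewrite rmorphXn rmorph_nat.
- move=> r; have [a [b rE]] := qs_ex (val r).
  have [|x [y [ax by_]]] := @integral_qs a b; first by rewrite -rE; apply: valP.
  exists x, y; apply: val_inj; rewrite valE rE ax by_.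
  by rewrite -!(rmorph_int (in_alg K)) mulr_algl.
- move=> x y /(congr1 val); rewrite valE rmorph0 -!(rmorph_int (in_alg K)) mulr_algl.
  by case/qs_eq0 => /eqP + /eqP; rewrite !intr_eq0 => /eqP -> /eqP ->.
Qed.
End Qsqrt2.

(** * The generating function of the ideals *)

Section Assembly.
Variables (A : comNzRingType) (s : A).
Hypothesis hA : is_Zsqrt2 s.

Local Notation X := (fpsX int : fps int).

Let term (a : set A) : fps int := (-1) ^+ ideal_norm a * X ^+ ideal_norm a.

Definition cone_pairs (n : nat) : seq (nat * nat) :=
  [seq (i, j) | i <- iota 0 n, j <- iota 0 (2 * i).+2].

Lemma cone_pairsP n p : (p \in cone_pairs n) = (p.1 < n)%N && (p.2 < (2 * p.1).+2)%N.
Proof.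
apply/allpairsPdep/andP => [[i [j []]]|[]].
  by rewrite !mem_iota !add0n /= => i_lt j_lt ->.
by exists p.1, p.2; rewrite !mem_iota !add0n /=; split=> //; case: (p).
Qed.

Lemma cone_pairs_uniq n : uniq (cone_pairs n).
Proof.
apply: allpairs_uniq_dep => [|i _|]; try exact: iota_uniq.
by move=> [i j] [i' j'] _ _ /= [-> ->].
Qed.

Lemma term_cone_ideal_eq0 n p : cone_index p -> p \notin cone_pairs n ->
  term (cone_ideal s p) n = 0.
Proof.
move=> pC; rewrite cone_pairsP (pC : (p.2 < _)%N) andbT -leqNgt => np.
apply: fps_coefMX_eq0; rewrite (ideal_norm_cone_ideal hA) //.
by rewrite /cone_norm mulSn !addSn ltnS (leq_trans np) // -addnA leq_addr.
Qed.

Lemma term_summable : fps_summable (nonzero_ideals A) term.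
Proof.
move=> n; apply: (@sub_finite_set _ _ (cone_ideal s @` [set` cone_pairs n])%classic).
  move=> a [an0 an]; have [_ _ surj] := cone_ideal_bij hA.
  have [p pC pa] := surj a an0; exists p => //=.
  by apply: contraNT (an : term a n != 0) => /(term_cone_ideal_eq0 pC) /eqP; rewrite pa.
exact/finite_image/finite_seq.
Qed.

Lemma term_sum_coef n : fps_sum (nonzero_ideals A) term n =
  \sum_(i < n) \sum_(j < (2 * i).+2)
    ((-1) ^+ cone_norm (i : nat, j : nat) * X ^+ cone_norm (i : nat, j : nat)) n.
Proof.
rewrite /fps_sum /= (reindex_fsbig (cone_ideal s) cone_index (nonzero_ideals A)
  (fun a => term a n) (cone_ideal_bij hA)).
rewrite (@fsbigE _ _ _ _ _ (cone_pairs n)) ?cone_pairs_uniq //; last first.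
- by move=> p; apply: term_cone_ideal_eq0.
- by move=> p /=; rewrite cone_pairsP => /andP [].
pose F p : int := ((-1) ^+ cone_norm p * X ^+ cone_norm p : fps int) n.
transitivity (\sum_(p <- cone_pairs n) F p).
  rewrite [LHS]big_mkcond [LHS]big_seq [RHS]big_seq; apply: eq_bigr => p pn.
  have pC : cone_index p by move: pn; rewrite cone_pairsP => /andP [].
  by rewrite mem_set // /term (ideal_norm_cone_ideal hA).
rewrite /cone_pairs big_allpairs_dep.
rewrite -[RHS](big_mkord xpredT (fun i => \sum_(j < (2 * i).+2) F (i, j : nat)))
  /index_iota subn0.
apply: eq_bigr => i _.
by rewrite -[RHS](big_mkord xpredT (fun j => F (i, j))) /index_iota subn0.
Qed.
End Assembly.

Theorem theorem1p4 (K : fieldExtType rat) (hK : is_Qsqrt2 K) :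
  let O_K : comNzRingType := ring_of_integers K in
  let term (a : set O_K) : fps int :=
    (-1) ^+ ideal_norm a * 'q ^+ ideal_norm a in
  fps_summable (nonzero_ideals O_K) term
  /\ f4 = - fps_sum (nonzero_ideals O_K) term.
Proof.
case: hK => s s2 sK O_K term.
have [t ht] := ring_of_integers_Zsqrt2 s2 sK.
split; first exact: (term_summable ht).
apply/fpsP => n; rewrite fps_coefN (term_sum_coef ht) (f4_coef (leqnn n)) -sumrN.
apply: eq_bigr => i _; rewrite -sumrN cone_polyE mulr_sumr fps_coef_sum.
apply: eq_bigr => j _; rewrite -fps_coefN; congr (fps_coef _ n).
rewrite mulrCA -exprD -mulNr /cone_norm /=; congr (_ * _).
rewrite exprS mulN1r -signr_odd -[in RHS]signr_odd; congr (- (_ ^+ nat_of_bool _)).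
(* The form 2 y^2 - x^2 has the parity of x = j - i. *)
have ji : (j <= (2 * i).+1)%N by rewrite -ltnS.
rewrite !oddD !oddM oddB //= oddM /=; by case: (odd i); case: (odd j).
Qed.
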